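(* Let $k\geq 2$ be an integer and let $P_k(n)$ denote the number of privileged words of length $n$ over the alphabet $\Sigma_k=\{0,1,\ldots,k-1\}$. Define $\log_k^{\circ 0}(n)=n$ and $\log_k^{\circ j}(n)=\log_k(\log_k^{\circ j-1}(n))$ for $j\geq 1$ (empty products equal $1$). (a) For every integer $j\geq 0$ there exist constants $N_j>0$ and $c_j>0$ such that \[P_k(n)\geq c_j\frac{k^n}{n\,\log_k^{\circ j}(n)\prod_{i=1}^{j}\log_k^{\circ i}(n)}\quad\text{for all } n>N_j.\] (b) For every integer $j\geq 0$ there exist constants $N_j'>0$ and $c_j'>0$ such that \[P_k(n)\leq c_j'\frac{k^n}{n\prod_{i=1}^{j}\log_k^{\circ i}(n)}\quad\text{for all } n>N_j'.\]
   Context: A word $u$ is a factor of a word $w$ if $w=xuy$ for some words $x,y$; occurrences are counted as factor positions (overlaps allowed). A border of a word $w$ is a non-empty word $u$ that is both a proper prefix and a proper suffix of $w$. A word $w$ is closed by a word $u$ if $u$ is a border of $w$ and $u$ occurs exactly twice in $w$. A word $w$ is privileged if $|w|\leq 1$ or if $w$ is closed by some privileged word (a recursive definition on length). *)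

(* Defs.v *)
From mathcomp Require Import all_boot.
From Stdlib Require Import Reals.
Set Implicit Arguments. Unset Strict Implicit. Unset Printing Implicit Defensive.

Section Words.
Variable T : eqType.

Definition occ (u w : seq T) : nat :=
  count (fun i => take (size u) (drop i w) == u) (iota 0 (size w - size u).+1).

Definition border (u w : seq T) : bool :=
  [&& 0 < size u, size u < size w, prefix u w & suffix u w].

Definition closed_by (w u : seq T) : bool := border u w && (occ u w == 2).

(* privileged words, recursion on length implemented with fuel;
   borders of w are exactly the prefixes take i w with 1 <= i < size w *)
Fixpoint priv_fuel (m : nat) (w : seq T) : bool :=
  (size w <= 1) ||
  match m with
  | 0 => false
  | m'.+1 => has (fun i => priv_fuel m' (take i w) && closed_by w (take i w))
                 (iota 1 (size w).-1)
  end.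

Definition privileged (w : seq T) : bool := priv_fuel (size w) w.
End Words.

Definition Pk (k n : nat) : nat :=
  #|[set w : n.-tuple 'I_k | privileged (tval w)]|.

Open Scope R_scope.
Definition logk (k : nat) (x : R) : R := ln x / ln (INR k).
Fixpoint iterlog (k j : nat) (x : R) : R :=
  match j with O => x | S j' => logk k (iterlog k j' x) end.
Fixpoint prodlog (k j : nat) (x : R) : R :=
  match j with O => 1 | S j' => prodlog k j' x * iterlog k (S j') x end.
Close Scope R_scope.

(* Main.v *)
Require Import Defs.
From Stdlib Require Import Reals Lra FunctionalExtensionality.
From mathcomp Require Import all_boot zify.
Set Implicit Arguments. Unset Strict Implicit. Unset Printing Implicit Defensive.

(* For a word u of length t let B(n,u) be the number of words of length n closed by u.

   Upper bound. Cut a word closed by u in the middle: the left half contains u only as a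
   prefix, the right half only as a suffix. By rotation, at most k^h / (h - t + 1) words of
   length h contain u only as a prefix, hence B(n,u) <= 16 k^n / n^2 when 4t <= n. With
   B(n,u) <= k^(n-2t), and at most k^(n-t) words having a border of length t, taking
   L = trunc(log_k n) yields
     P(n) <= 16 (k^n / n^2) sum_{t <= L} P(t) + sum_{L < t <= 2L} P(t) k^(n-2t) + 2 k^(n-2L-1),
   so a bound P(t) = O(k^t / F(t)) improves to P(n) = O(k^n / (n F(log_k n))).

   Lower bound. Count only the privileged words whose first letter differs from the second
   and the third ("seeds"): such a u has no period 1 or 2, so a union bound over the
   positions of a third occurrence of u in u z u gives 4 B(n,u) >= k^(n-2t) once
   k^t >= 4n. With k^t of order n, a lower bound k^t / F(t) propagates to
   k^n / (n F(log_k n)); the start, of order k^n / n^2, only needs one seed of each length. *)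

(** * Words and occurrences *)

Lemma leq_size_inj (A B : eqType) (f : A -> B) (s : seq A) (r : seq B) :
  uniq s -> {in s &, injective f} -> {in s, forall x, f x \in r} ->
  size s <= size r.
Proof.
move=> us fi fr; rewrite -(size_map f); apply: uniq_leq_size.
  by rewrite map_inj_in_uniq.
by move=> _ /mapP[x xs ->]; exact: fr.
Qed.

Lemma leq_in_count (A : eqType) (P Q : pred A) (s : seq A) :
  {in s, forall x, P x -> Q x} -> count P s <= count Q s.
Proof.
move=> PQ; rewrite (@eq_in_count _ P (predI P Q)); first by apply: sub_count => x /andP[].
by move=> x xs /=; case Px: (P x); rewrite //= PQ.
Qed.

(** Double counting with fibres of size at most [b / a], cleared of division so that bounds such as
    [16 k^n / n^2] stay in [nat]. *)
Lemma leq_size_fibers (A B : eqType) (f : A -> B) (s : seq A) (r : seq B) a b :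
  {in s, forall x, f x \in r} ->
  {in r, forall u, count (fun x => f x == u) s * a <= b} ->
  size s * a <= size r * b.
Proof.
elim: r s => [|u r IH] s fr cr.
  by case: s fr {cr} => // x s /(_ x (mem_head _ _)).
rewrite -(count_predC (fun x => f x == u)) mulnDl /= mulSn leq_add ?cr ?mem_head //.
rewrite -size_filter; apply: IH => [x|v vr].
  rewrite mem_filter => /andP[/= fx xs]; move: (fr x xs).
  by rewrite inE (negPf fx).
apply: leq_trans (cr v _); last by rewrite inE vr orbT.
by rewrite leq_mul2r count_filter sub_count ?orbT // => x /andP[].
Qed.

Lemma geq_size_fibers (A B : eqType) (f : A -> B) (s : seq A) (r : seq B) a b :
  uniq r -> {in r, forall u, b <= a * count (fun x => f x == u) s} ->
  size r * b <= a * size s.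
Proof.
elim: r s => [|u r IH] s //= /andP[ur uniqr] cr.
rewrite -(count_predC (fun x => f x == u)) mulnDr mulSn leq_add ?cr ?mem_head //.
rewrite -size_filter; apply: IH => // v vr.
apply: leq_trans (cr v _) _; first by rewrite inE vr orbT.
rewrite leq_mul2l count_filter; apply/orP; right.
apply: sub_count => x /= /eqP->; rewrite eqxx /=.
by apply: contraNneq ur => <-.
Qed.

(** Serves both bounds: the first count vanishes in the upper one and is the quantity sought in the
    lower one. *)
Lemma count_union_bound (A I : Type) (P : pred A) (E : I -> pred A) (s : seq A) (l : seq I) :
  count P s <= count (fun w => P w && ~~ has (E^~ w) l) s
               + \sum_(p <- l) count (fun w => P w && E p w) s.
Proof.
elim: l => [|p l IH] /=.
  by rewrite big_nil addn0 sub_count // => w /=; rewrite andbT.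
apply: leq_trans IH _; rewrite big_cons addnA leq_add2r addnC.
rewrite -count_predUI; apply: leq_trans (leq_addr _ _); apply: sub_count => w /=.
by case: (P w) => //=; case: (E p w).
Qed.

Section Words.
Variable T : finType.
Implicit Types (u v w : seq T).

Definition words n : seq (seq T) := [seq tval x | x <- enum {: n.-tuple T}].

Lemma words_uniq n : uniq (words n).
Proof. by rewrite map_inj_uniq ?enum_uniq //; exact: val_inj. Qed.

Lemma mem_words n w : (w \in words n) = (size w == n).
Proof.
apply/mapP/eqP => [[x _ ->]|sw]; first by rewrite size_tuple.
have szw : size w == n by apply/eqP.
by exists (Tuple szw); rewrite ?mem_enum.
Qed.

Lemma size_words n : size (words n) = #|T| ^ n.
Proof. by rewrite size_map -cardE card_tuple. Qed.

Lemma count_words n (P : pred (seq T)) :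
  #|[set x : n.-tuple T | P (tval x)]| = count P (words n).
Proof.
by rewrite count_map -sum1_card -sum1_count big_enum_cond /=; apply: eq_bigl => x; rewrite inE.
Qed.

(** * Occurrences, closed words and privileged words *)

Definition at_pos u w i := take (size u) (drop i w) == u.

Lemma at_pos_take u w h i : i + size u <= h -> at_pos u (take h w) i = at_pos u w i.
Proof.
by move=> ih; rewrite /at_pos !take_drop take_takel // addnC.
Qed.

Lemma at_pos_drop u w h i : at_pos u (drop h w) i = at_pos u w (i + h).
Proof. by rewrite /at_pos drop_drop. Qed.

Lemma closed_byE w u : 0 < size u < size w ->
  closed_by w u = [&& at_pos u w 0, at_pos u w (size w - size u)
     & ~~ has (at_pos u w) (iota 1 (size w - size u).-1)].
Proof.
move=> /andP[u0 uw]; rewrite /closed_by /border u0 uw /= prefixE suffixE.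
rewrite /occ /at_pos drop0; set m := size w - size u.
have m0 : 0 < m by rewrite subn_gt0.
have sd : take (size u) (drop m w) = drop m w.
  by rewrite take_oversize // size_drop subKn // ltnW.
case E0 : (_ == u) => //=; rewrite drop0 E0 sd; case Em : (drop m w == u) => //=.
rewrite -[X in iota 1 X](prednK m0) -[m.-1.+1]addn1 iotaD count_cat /= add1n.
by rewrite add1n prednK // sd Em has_count -leqNgt leqn0 addn0 addn1 !eqSS.
Qed.

(** Closing words are strictly shorter, so fuel never runs out once it reaches the length; this
    gives the fuel-free unfolding [privilegedE]. *)
Lemma priv_fuelE m1 m2 w : size w <= m1 -> size w <= m2 ->
  priv_fuel m1 w = priv_fuel m2 w.
Proof.
have small m : size w <= 1 -> priv_fuel m w by case: m => [|m] /= ->.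
elim: m1 m2 w small => [|m1 IH] [|m2] w small w1 w2; try by rewrite !small //; lia.
rewrite /=; case: leqP => //= sw; apply: eq_in_has => /= i.
rewrite mem_iota => /andP[i1 iw]; congr (_ && _).
apply: IH => [[|m] /= -> //||]; rewrite size_takel //; lia.
Qed.

Lemma privilegedE w : privileged w = (size w <= 1) ||
  has (fun i => privileged (take i w) && closed_by w (take i w)) (iota 1 (size w).-1).
Proof.
rewrite {1}/privileged; case sw: (size w) => [|m] //=; first by rewrite sw.
rewrite sw; congr (_ || _); apply: eq_in_has => /= i.
rewrite mem_iota => /andP[i1 iw]; congr (_ && _).
by apply: priv_fuelE; rewrite ?size_takel //; lia.
Qed.

Lemma closed_by_privileged u w : privileged u -> closed_by w u -> privileged w.
Proof.
move=> pu cu; have /and4P[u0 uw pre _] := proj1 (andP cu).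
rewrite privilegedE; apply/orP; right; apply/hasP; exists (size u).
  by rewrite mem_iota add1n prednK ?u0 //; apply: leq_trans uw.
by move: pre; rewrite prefixE => /eqP ->; rewrite pu.
Qed.

(** * Words containing a factor only at one end *)

Definition unique_prefix u v :=
  at_pos u v 0 && ~~ has (at_pos u v) (iota 1 (size v - size u)).
Definition unique_suffix u v :=
  at_pos u v (size v - size u) && ~~ has (at_pos u v) (iota 0 (size v - size u)).

Lemma at_pos_catl u x y p : p + size u <= size x ->
  at_pos u (x ++ y) p = at_pos u x p.
Proof. by move=> h; rewrite -(at_pos_take (x ++ y) h) take_size_cat. Qed.

Lemma at_pos_catr u x y p : at_pos u (x ++ y) (p + size x) = at_pos u y p.
Proof. by rewrite -at_pos_drop drop_size_cat. Qed.

Lemma at_pos_rot u v i p : i + p + size u <= size v ->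
  at_pos u (rot i v) p = at_pos u v (p + i).
Proof.
by move=> h; rewrite /rot at_pos_catl ?size_drop ?at_pos_drop //; lia.
Qed.

Lemma at_pos_rotr u v i p : i <= size v -> p + i + size u <= size v ->
  at_pos u (rotr i v) (p + i) = at_pos u v p.
Proof.
move=> iv h; have sd : size (drop (size v - i) v) = i by rewrite size_drop subKn.
by rewrite /rotr /rot -[X in at_pos _ _ (p + X)]sd at_pos_catr at_pos_take //; lia.
Qed.

(* If [u] occurs in [v] only as a suffix, the first occurrence of [u] in [rot i v] is at
   [h - size u - i], so [(i, v)] can be recovered from [rot i v]; dually for prefixes. *)
Lemma count_unique_suffix u h : size u <= h ->
  (h - size u).+1 * count (unique_suffix u) (words h) <= #|T| ^ h.
Proof.
move=> uh; rewrite -size_words -[X in X * _](size_iota 0) -size_filter.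
rewrite -(size_allpairs pair).
apply: (@leq_size_inj _ _ (fun iv : nat * seq T => rot iv.1 iv.2)).
- by apply: allpairs_uniq; rewrite ?iota_uniq ?filter_uniq ?words_uniq // => -[? ?] [].
- have key i v j v' : size v = h -> size v' = h -> unique_suffix u v -> unique_suffix u v' ->
      i < j -> j <= h - size u -> rot i v = rot j v' -> False.
    move=> sv sv' /andP[_ /hasPn nv] /andP[av' _] ij jh e.
    have := congr1 (fun x => at_pos u x (h - size u - j)) e.
    rewrite !at_pos_rot ?sv ?sv' ?subnK //; try lia.
    rewrite sv' in av'; rewrite av'; apply/negP/nv; rewrite mem_iota sv; lia.
  move=> [i v] [j v'] /allpairsP[[i1 v1] [i1h v1h [-> ->]]].
  move=> /allpairsP[[i2 v2] [i2h v2h [-> ->]]] /= e; move: i1h v1h i2h v2h.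
  rewrite !mem_iota !mem_filter !mem_words /= !add0n !ltnS.
  move=> ih /andP[uv1 /eqP s1] jh /andP[uv2 /eqP s2].
  have [ij|ij|ij] := ltngtP i1 i2.
  + by case: (key i1 v1 i2 v2).
  + by case: (key i2 v2 i1 v1).
  + by move: e; rewrite ij => /rot_inj->.
- move=> [i v] /allpairsP[[i1 v1] /= [_ + [-> ->]]].
  by rewrite mem_filter !mem_words size_rot => /andP[].
Qed.

Lemma count_unique_prefix u h : size u <= h ->
  (h - size u).+1 * count (unique_prefix u) (words h) <= #|T| ^ h.
Proof.
move=> uh; rewrite -size_words -[X in X * _](size_iota 0) -size_filter.
rewrite -(size_allpairs pair).
apply: (@leq_size_inj _ _ (fun iv : nat * seq T => rotr iv.1 iv.2)).
- by apply: allpairs_uniq; rewrite ?iota_uniq ?filter_uniq ?words_uniq // => -[? ?] [].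
- have key i v j v' : size v = h -> size v' = h -> unique_prefix u v -> unique_prefix u v' ->
      i < j -> j <= h - size u -> rotr i v = rotr j v' -> False.
    move=> sv sv' /andP[_ /hasPn nv] /andP[av' _] ij jh e.
    have := congr1 (fun x => at_pos u x j) e.
    rewrite -{1}(subnK (ltnW ij)) -[X in at_pos u _ X = at_pos _ (rotr j _) _]add0n.
    rewrite -[X in at_pos u (rotr j _) X]add0n !at_pos_rotr ?sv ?sv' //; try lia.
    rewrite av'; apply/negP/nv; rewrite mem_iota sv; lia.
  move=> [i v] [j v'] /allpairsP[[i1 v1] [i1h v1h [-> ->]]].
  move=> /allpairsP[[i2 v2] [i2h v2h [-> ->]]] /= e; move: i1h v1h i2h v2h.
  rewrite !mem_iota !mem_filter !mem_words /= !add0n !ltnS.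
  move=> ih /andP[uv1 /eqP s1] jh /andP[uv2 /eqP s2].
  have [ij|ij|ij] := ltngtP i1 i2.
  + by case: (key i1 v1 i2 v2).
  + by case: (key i2 v2 i1 v1).
  + by move: e; rewrite ij => /rotr_inj->.
- move=> [i v] /allpairsP[[i1 v1] /= [_ + [-> ->]]].
  by rewrite mem_filter !mem_words size_rotr => /andP[].
Qed.

(** The two occurrences fall in different parts, neither part can contain another one, and the parts
    determine the word. *)
Lemma count_closed_split u n h : 0 < size u <= h -> h + size u <= n ->
  count (fun w => closed_by w u) (words n) <=
  count (unique_prefix u) (words h) * count (unique_suffix u) (words (n - h)).
Proof.
move=> uh hn; rewrite -!size_filter -(size_allpairs pair).
apply: (@leq_size_inj _ _ (fun w => (take h w, drop h w))).
- by rewrite filter_uniq ?words_uniq.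
- by move=> x y _ _ [e1 e2]; rewrite -(cat_take_drop h x) e1 e2 cat_take_drop.
- move=> w; rewrite mem_filter mem_words => /andP[+ /eqP sw].
  rewrite closed_byE ?sw; last lia.
  move=> /and3P[a0 an /hasPn nw]; apply: (allpairs_f pair).
    have st : size (take h w) = h by rewrite size_takel // sw; lia.
    rewrite mem_filter mem_words /unique_prefix st eqxx andbT at_pos_take ?a0; last lia.
    apply/hasPn => /= i; rewrite mem_iota => hi; rewrite at_pos_take; last lia.
    by apply: nw; rewrite mem_iota; lia.
  rewrite mem_filter mem_words size_drop sw eqxx andbT /unique_suffix size_drop sw.
  rewrite at_pos_drop (_ : n - h - size u + h = n - size u) ?an; last lia.
  by apply/hasPn => /= i; rewrite mem_iota at_pos_drop => hi; apply: nw; rewrite mem_iota; lia.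
Qed.

Lemma count_closed_upper u n : 0 < size u -> 4 * size u <= n ->
  count (fun w => closed_by w u) (words n) * n ^ 2 <= 16 * #|T| ^ n.
Proof.
move=> u0 un; set h := n./2.
have hh : h = n./2 by [].
have B := @count_closed_split u n h _ _.
have := leq_mul (@count_unique_prefix u h _) (@count_unique_suffix u (n - h) _).
rewrite mulnACA -expnD subnKC; last lia.
move=> /(_ _ _) K.
have {}K := K ltac:(lia) ltac:(lia); have {}B := B ltac:(lia) ltac:(lia).
(* Each half leaves at least [n / 4] positions for [u], whence [16 = 4 * 4]. *)
have L : n ^ 2 <= 16 * ((h - size u).+1 * (n - h - size u).+1).
  by rewrite -[16]/(4 * 4) mulnACA -mulnn; apply: leq_mul; lia.
apply: leq_trans (leq_mul B L) _; rewrite mulnCA leq_mul2l /= mulnC; exact: K.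
Qed.

(** * Counting words with prescribed blocks *)

Lemma take_drop_cat i j w : take i (drop j w) ++ drop (j + i) w = drop j w.
Proof. by rewrite addnC -drop_drop cat_take_drop. Qed.

(** Only the letters in [[a, b)] and [[b + e, d)] remain free. With [a = b] and [e = 0] the first
    gap and the middle block disappear. *)
Lemma count_two_gaps n a b e d x y z : a <= b -> b + e <= d -> d <= n ->
  count (fun w => [&& take a w == x, take e (drop b w) == y & drop d w == z]) (words n)
  <= #|T| ^ (b - a) * #|T| ^ (d - (b + e)).
Proof.
move=> ab bd dn; rewrite -!size_words -size_filter -(size_allpairs pair).
apply: (@leq_size_inj _ _
  (fun w => (take (b - a) (drop a w), take (d - (b + e)) (drop (b + e) w)))).
- by rewrite filter_uniq ?words_uniq.
- have split w : w = take a w ++ take (b - a) (drop a w) ++ take e (drop b w)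
      ++ take (d - (b + e)) (drop (b + e) w) ++ drop d w.
    have h1 := take_drop_cat (d - (b + e)) (b + e) w.
    have h2 := take_drop_cat (b - a) a w.
    by rewrite subnKC // in h1; rewrite subnKC // in h2; rewrite h1 take_drop_cat h2 cat_take_drop.
  move=> v w; rewrite !mem_filter => /andP[/and3P[/eqP v1 /eqP v2 /eqP v3] _].
  move=> /andP[/and3P[/eqP w1 /eqP w2 /eqP w3] _] [e1 e2].
  by rewrite (split v) (split w) v1 v2 v3 w1 w2 w3 e1 e2.
- move=> w; rewrite mem_filter mem_words => /andP[_ /eqP sw].
  by apply: (allpairs_f pair); rewrite mem_words size_takel // size_drop sw; lia.
Qed.

Lemma count_fixed_border u n : 2 * size u <= n -> 0 < size u ->
  count (fun w => closed_by w u) (words n) <= #|T| ^ (n - 2 * size u).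
Proof.
move=> un u0; set t := size u.
have := @count_two_gaps n t t 0 (n - t) u [::] u (leqnn _).
rewrite subnn expn0 mul1n addn0 (_ : n - t - t = n - 2 * t); last lia.
move=> H; apply: leq_trans (H _ _); [|lia..].
apply: leq_in_count => w; rewrite mem_words => /eqP sw.
rewrite closed_byE ?sw; last lia.
rewrite /at_pos drop0 take0 -/t eqxx => /and3P[-> an _] /=.
by move: an; rewrite take_oversize // size_drop sw; lia.
Qed.

(** A border of length [t], possibly overlapping itself, forces the period [n - t], so the first
    [n - t] letters determine the word. *)
Lemma count_border n t : t < n ->
  count (fun w => take t w == drop (n - t) w) (words n) <= #|T| ^ (n - t).
Proof.
move=> tn; rewrite -size_words -size_filter.
apply: (@leq_size_inj _ _ (take (n - t))).
- by rewrite filter_uniq ?words_uniq.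
- move=> v w; rewrite !mem_filter !mem_words => /andP[/eqP bv /eqP sv] /andP[/eqP bw /eqP sw] e.
  (* [t < n] makes [v] non-empty, which provides a default letter for [nth]. *)
  have [x0 _] : {x0 : T | true} by case: v sv {bv e} => [|x0 v] => [/= sv|_]; [lia|exists x0].
  apply: (@eq_from_nth _ x0); rewrite ?sv ?sw //.
  elim/ltn_ind => i IH iN; have [it|ti] := ltnP i (n - t).
    by rewrite -(nth_take x0 it v) e nth_take.
  have step x : take t x = drop (n - t) x -> nth x0 x i = nth x0 x (i - (n - t)).
    by move=> bx; rewrite -{1}(subnKC ti) -nth_drop -bx nth_take //; lia.
  by rewrite !step // IH //; lia.
- by move=> w; rewrite mem_filter !mem_words => /andP[_ /eqP sw]; rewrite size_takel // sw; lia.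
Qed.

(** * Upper bounds by length of the closing border *)

Definition npriv n := count (@privileged T) (words n).
Definition npriv_border n t :=
  count (fun w => privileged (take t w) && closed_by w (take t w)) (words n).

Lemma npriv_le_sum n : 1 < n -> npriv n <= \sum_(1 <= t < n) npriv_border n t.
Proof.
move=> n1; apply: leq_trans (count_union_bound _ (fun t w =>
  privileged (take t w) && closed_by w (take t w)) _ (iota 1 n.-1)) _.
(* No word escapes the union: a privileged word of length above [1] is closed by a privileged
   prefix. *)
rewrite [X in X + _](_ : _ = 0) ?add0n.
  rewrite big_seq [X in _ <= X]big_seq /index_iota subn1; apply: leq_sum => t _.
  by apply: sub_count => w /andP[].
apply/eqP; rewrite -leqn0 leqNgt -has_count; apply/hasPn => w.
rewrite mem_words => /eqP sw; rewrite privilegedE sw.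
by rewrite leqNgt n1 /=; case: has.
Qed.

(** The fibre over a prefix [u] of length [t] consists of words closed by [u], and only privileged
    [u] have a non-empty fibre. *)
Lemma npriv_border_fibers n t a b : t <= n ->
  (forall u, size u = t -> count (fun w => closed_by w u) (words n) * a <= b) ->
  npriv_border n t * a <= npriv t * b.
Proof.
move=> tn H; rewrite /npriv_border /npriv -!size_filter.
apply: (@leq_size_fibers _ _ (take t)) => [w|u].
  rewrite !mem_filter !mem_words => /andP[/andP[-> _] /eqP sw].
  by rewrite size_takel ?eqxx // sw.
rewrite mem_filter mem_words => /andP[_ /eqP su].
apply: leq_trans (H u su); rewrite leq_mul2r count_filter sub_count ?orbT //.
by move=> w /= /andP[/eqP -> /andP[]].
Qed.

Lemma npriv_border_small n t : 0 < t -> 4 * t <= n ->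
  npriv_border n t * n ^ 2 <= npriv t * (16 * #|T| ^ n).
Proof.
move=> t0 tn; apply: npriv_border_fibers => [|u su]; first lia.
by apply: count_closed_upper; rewrite su.
Qed.

Lemma npriv_border_medium n t : 0 < t -> 2 * t <= n ->
  npriv_border n t <= npriv t * #|T| ^ (n - 2 * t).
Proof.
move=> t0 tn; rewrite -[X in X <= _]muln1; apply: npriv_border_fibers => [|u su]; first lia.
by rewrite muln1 -su count_fixed_border // su.
Qed.

Lemma npriv_border_large n t : 0 < t -> t < n -> npriv_border n t <= #|T| ^ (n - t).
Proof.
move=> t0 tn; apply: leq_trans (count_border tn).
apply: leq_in_count => w; rewrite mem_words => /eqP sw /andP[_].
have st : size (take t w) = t by rewrite size_takel // sw ltnW.
rewrite closed_byE ?st ?sw ?t0 // /at_pos drop0 st => /and3P[_ an _].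
by move: an; rewrite take_oversize 1?eq_sym // size_drop sw; lia.
Qed.

(** * Seeds and a lower bound for closed words *)

Definition seed u := if u is [:: x, y, z & _] then (x != y) && (x != z) else false.

Lemma seed_size u : seed u -> 2 < size u.
Proof. by case: u => [|x [|y [|z u]]]. Qed.

Lemma at_pos_nth x0 u w i j : at_pos u w i -> j < size u -> nth x0 u j = nth x0 w (i + j).
Proof. by move=> /eqP ui ju; rewrite -{1}ui nth_take // nth_drop. Qed.

(** Two occurrences at distance [q] equate the first letter of [u] with its second or third. *)
Lemma seed_no_short_period u w i q : seed u -> 0 < q < 3 ->
  at_pos u w i -> at_pos u w (i + q) -> false.
Proof.
move=> su q3 ai aq; have tu := seed_size su.
case: u su ai aq tu => [|x [|y [|z u]]] //= /andP[xy xz] ai aq tu.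
have := at_pos_nth x aq (isT : 0 < size [:: x, y, z & u]).
have qs : q < size [:: x, y, z & u] by rewrite /=; lia.
rewrite addn0 -(at_pos_nth x ai qs).
by case: q q3 {ai aq qs} => [|[|[|q]]] //= _ /eqP; rewrite ?(negPf xy) ?(negPf xz).
Qed.

Lemma count_ends u n : 2 * size u <= n ->
  #|T| ^ (n - 2 * size u) <= count (fun w => at_pos u w 0 && at_pos u w (n - size u)) (words n).
Proof.
move=> un; rewrite -size_words -size_filter.
apply: (@leq_size_inj _ _ (fun z => u ++ z ++ u)) => [|x y|z]; first exact: words_uniq.
  rewrite !mem_words => /eqP sx /eqP sy /eqP; rewrite eqseq_cat // eqxx /=.
  by rewrite eqseq_cat ?sx ?sy // => /andP[/eqP].
rewrite mem_words => /eqP sz; rewrite mem_filter mem_words /at_pos drop0 take_size_cat // eqxx.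
rewrite catA drop_size_cat ?size_cat ?sz; last lia.
by rewrite take_size eqxx /=; apply/eqP; lia.
Qed.

Section OccurrencesBetween.
Variables (n : nat) (u : seq T).
Local Notation t := (size u).
Hypotheses (su : seed u) (tn : 3 * t < n).

Let bad p := count (fun w => at_pos u w 0 && at_pos u w (n - t) && at_pos u w p) (words n).

(** An occurrence at [p <= t] overlaps or abuts the prefix [u], so the first [p + t] letters are
    fixed. *)
Lemma count_occurrence_left p : 0 < p <= t -> bad p <= if p < 3 then 0 else #|T| ^ (n - 2 * t - p).
Proof.
move=> pt; case: ltnP => p3.
  rewrite leqn0 -[_ == 0]negbK -lt0n -has_count; apply/hasPn => w _; apply/negP.
  move=> /andP[/andP[a0 _] ap]; have: 0 < p < 3 by lia.
  by move=> /(seed_no_short_period su)/(_ a0 ap).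
have := @count_two_gaps n (p + t) (p + t) 0 (n - t) (take p u ++ u) [::] u (leqnn _).
rewrite subnn expn0 mul1n addn0 (_ : n - t - (p + t) = n - 2 * t - p); last lia.
move=> H; apply: leq_trans (H _ _); [|lia..].
apply: leq_in_count => w; rewrite mem_words => /eqP sw.
rewrite /at_pos drop0 take0 eqxx => /andP[/andP[/eqP a0 an] /eqP ap].
have -> : take p u = take p w by rewrite -{1}a0 take_takel //; lia.
rewrite takeD ap eqxx /=.
by move: an; rewrite take_oversize // size_drop sw; lia.
Qed.

(** Mirror image of the previous count, with [q] the distance to the final occurrence. *)
Lemma count_occurrence_right q : 0 < q <= t ->
  bad (n - t - q) <= if q < 3 then 0 else #|T| ^ (n - 2 * t - q).
Proof.
move=> qt; case: ltnP => q3.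
  rewrite leqn0 -[_ == 0]negbK -lt0n -has_count; apply/hasPn => w _; apply/negP.
  move=> /andP[/andP[_ an] aq]; have q03 : 0 < q < 3 by lia.
  by have := seed_no_short_period su q03 aq; rewrite subnK ?an; [move/(_ isT)|lia].
have := @count_two_gaps n t t 0 (n - t - q) u [::] (take q u ++ u) (leqnn _).
rewrite subnn expn0 mul1n addn0 (_ : n - t - q - t = n - 2 * t - q); last lia.
move=> H; apply: leq_trans (H _ _); [|lia..].
apply: leq_in_count => w; rewrite mem_words => /eqP sw.
rewrite /at_pos drop0 take0 eqxx => /andP[/andP[-> an] /eqP aq] /=.
have -> : take q u = take q (drop (n - t - q) w) by rewrite -{1}aq take_takel //; lia.
move: an; rewrite take_oversize; last by rewrite size_drop sw; lia.
move=> /eqP du; have := take_drop_cat q (n - t - q) w; rewrite subnK; last lia.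
by rewrite du => ->.
Qed.

Lemma count_occurrence_middle p : t <= p <= n - 2 * t -> bad p <= #|T| ^ (n - 3 * t).
Proof.
move=> pt.
have := @count_two_gaps n t p t (n - t) u u u.
rewrite -expnD (_ : p - t + (n - t - (p + t)) = n - 3 * t); last lia.
move=> H; apply: leq_trans (H _ _ _); [|lia..].
apply: leq_in_count => w; rewrite mem_words => /eqP sw.
rewrite /at_pos drop0 => /andP[/andP[-> an] ->] /=.
by move: an; rewrite take_oversize // size_drop sw; lia.
Qed.

(** With [k = #|T|] and [M = n - 2 t], the terms from [q = 3] on sum to at most
    [k^(M-2) <= k^M / 4]; the factor [4] comes from the vanishing terms [q = 1, 2]. *)
Lemma sum_overlap (f : nat -> nat) : 1 < #|T| ->
  (forall q, 0 < q <= t -> f q <= if q < 3 then 0 else #|T| ^ (n - 2 * t - q)) ->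
  4 * \sum_(1 <= q < t.+1) f q <= #|T| ^ (n - 2 * t).
Proof.
move=> k1 fq; have t3 := seed_size su; set M := n - 2 * t in fq *.
have tM : t <= M by rewrite /M; lia.
(* Keeping the last power on the left closes the induction, by [2 k^(M-s-1) <= k^(M-s)]. *)
have IH s : 1 < s -> s <= t -> \sum_(1 <= q < s.+1) f q + #|T| ^ (M - s) <= #|T| ^ (M - 2).
  elim: s => [//|[//|[|s]] IH] _ st.
    move: (fq 1 ltac:(lia)) (fq 2 ltac:(lia)) => /=.
    by rewrite big_ltn // big_ltn // big_geq //; lia.
  rewrite big_nat_recr //=; have := IH isT (ltnW st); have := fq s.+3 st.
  rewrite (_ : M - s.+2 = (M - s.+3).+1) ?expnS; last lia.
  have := leq_mul k1 (leqnn (#|T| ^ (M - s.+3))).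
  by rewrite ltnNge /=; lia.
have M2 : 2 <= M by lia.
have := leq_mul (leqnn 4) (leq_trans (leq_addr _ _) (IH t (ltnW t3) (leqnn _))).
move=> /leq_trans; apply; rewrite -{2}(subnK M2) expnD mulnC leq_mul2l.
by rewrite -[4]/(2 ^ 2) leq_exp2r // k1 orbT.
Qed.

(** Extra occurrences on the left, on the right and in the middle each spoil at most a quarter of
    [k^(n-2t)] words [u z u]; a quarter survives. *)
Lemma count_closed_lower : 1 < #|T| -> 4 * n <= #|T| ^ t ->
  #|T| ^ (n - 2 * t) <= 4 * count (fun w => closed_by w u) (words n).
Proof.
move=> k1 nt; have t3 := seed_size su.
have := leq_trans (@count_ends u n _)
  (count_union_bound _ (fun p w => at_pos u w p) _ (iota 1 (n - t).-1)).
move=> /(_ ltac:(lia)).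
rewrite (_ : count _ _ = count (fun w => closed_by w u) (words n)); last first.
  apply: eq_in_count => w; rewrite mem_words => /eqP sw.
  by rewrite closed_byE sw ?andbA //; lia.
rewrite (_ : iota _ _ = index_iota 1 (n - t)); last by rewrite /index_iota subn1.
have -> : \sum_(1 <= p < n - t)
    count (fun w => at_pos u w 0 && at_pos u w (n - t) && at_pos u w p) (words n)
  = \sum_(1 <= p < n - t) bad p by [].
rewrite (@big_cat_nat _ _ _ t.+1) /=; [|lia..].
rewrite (@big_cat_nat _ _ _ (n - 2 * t) t.+1) /=; [|lia..].
have Sl : 4 * \sum_(1 <= q < t.+1) bad q <= #|T| ^ (n - 2 * t).
  by apply: sum_overlap => // q; exact: count_occurrence_left.
(* Reindexing by the distance [q = n - t - p] reduces this range to [sum_overlap]. *)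
have Sr : 4 * \sum_(n - 2 * t <= p < n - t) bad p <= #|T| ^ (n - 2 * t).
  have := @sum_overlap (fun q => bad (n - t - q)) k1 count_occurrence_right.
  rewrite big_add1 /= big_mkord.
  by rewrite big_rev_mkord (_ : n - t - (n - 2 * t) = t) //; lia.
have Sm : 4 * \sum_(t.+1 <= p < n - 2 * t) bad p <= #|T| ^ (n - 2 * t).
  (* At most [n] positions with [k^(n-3t)] words each, and [4 n <= k^t]. *)
  apply: (@leq_trans (4 * (n * #|T| ^ (n - 3 * t)))).
    rewrite leq_mul2l /= (@leq_trans (\sum_(t.+1 <= p < n - 2 * t) #|T| ^ (n - 3 * t))) //.
      rewrite big_nat [X in _ <= X]big_nat; apply: leq_sum => p pt.
      by apply: count_occurrence_middle; lia.
    by rewrite sum_nat_const_nat leq_mul2r; apply/orP; right; lia.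
  rewrite mulnA (_ : n - 2 * t = t + (n - 3 * t)); last lia.
  by rewrite expnD leq_mul2r nt orbT.
move: Sl Sr Sm; move: (\sum_(1 <= q < t.+1) _) (\sum_(n - 2 * t <= p < n - t) _).
move: (\sum_(t.+1 <= p < n - 2 * t) _) (count _ _) (#|T| ^ _) => a b c d e; lia.
Qed.

End OccurrencesBetween.

(** * Recursion for privileged seeds *)

Definition nseed n := count (fun w => seed w && privileged w) (words n).

Lemma nseed_le_npriv n : nseed n <= npriv n.
Proof. by apply: sub_count => w /andP[]. Qed.

(** A word closed by a seed starts with it and so is a seed again; this lets the recursion
    iterate. *)
Lemma seed_prefix u w : prefix u w -> seed u -> seed w.
Proof.
case/prefixP => v ->; case: u => [|x [|y [|z u]]] //.
Qed.

Lemma nseed_recursion n t : 1 < #|T| -> 3 * t < n -> 4 * n <= #|T| ^ t ->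
  nseed t * #|T| ^ (n - 2 * t) <= 4 * nseed n.
Proof.
move=> k1 tn nt; rewrite /nseed -!size_filter.
apply: (@geq_size_fibers _ _ (take t)) => [|u]; first by rewrite filter_uniq ?words_uniq.
rewrite mem_filter mem_words => /andP[/andP[su pu] /eqP ut]; rewrite -ut in tn nt *.
apply: leq_trans (count_closed_lower su tn k1 nt) _.
rewrite leq_mul2l count_filter /=; apply: sub_count => w cu /=.
have /and4P[_ _ pre _] := proj1 (andP cu).
by rewrite (seed_prefix pre su) (closed_by_privileged pu cu) -prefixE pre.
Qed.

Lemma nseed_gt0 n : 1 < #|T| -> 3 < n -> 0 < nseed n.
Proof.
case/card_gt1P => x [y [_ _ xy]] n3; rewrite -has_count; apply/hasP.
(* The word [x y ... y x] is closed by the letter [x]; [3 < n] puts [y] in third place. *)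
exists (x :: nseq (n - 2) y ++ [:: x]); first by rewrite mem_words /= size_cat size_nseq /=; lia.
apply/andP; split.
  by case: n n3 => [|[|[|[|n]]]] // _; rewrite !subSS subn0 /= xy.
apply: (@closed_by_privileged [:: x]) => //.
rewrite closed_byE /= size_cat size_nseq ?addn1 //= subn1 /=.
rewrite /at_pos /= take0 eqxx drop_size_cat ?size_nseq // eqxx /=.
apply/hasPn => /= i; rewrite mem_iota => hi.
have ix : i <= (n - 2) by lia.
case: i hi ix => // i _ ix.
rewrite /= drop_cat size_nseq ix drop_nseq.
by rewrite -[n - 2 - i]prednK ?subn_gt0 //= take0 eqseq_cons eq_sym (negPf xy).
Qed.

End Words.

(** * Asymptotics *)

Local Open Scope R_scope.

Lemma INR_addn m n : INR (m + n)%N = INR m + INR n.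
Proof. exact: plus_INR. Qed.

Lemma INR_muln m n : INR (m * n)%N = INR m * INR n.
Proof. exact: mult_INR. Qed.

Lemma INR_expn m n : INR (m ^ n)%N = INR m ^ n.
Proof. by elim: n => [|n IH] //=; rewrite expnS INR_muln IH. Qed.

Lemma INR_leq m n : (m <= n)%N -> INR m <= INR n.
Proof. by move=> /leP; exact: le_INR. Qed.

Lemma INR_sum_le (f g : nat -> nat) K a b :
  (forall t, (a <= t < b)%N -> INR (f t) <= K * INR (g t)) ->
  INR (\sum_(a <= t < b) f t) <= K * INR (\sum_(a <= t < b) g t).
Proof.
move=> fg; elim: b fg => [|b IH] fg; first by rewrite !big_geq //=; lra.
have [ab|ba] := leqP a b; last by rewrite !big_geq //=; lra.
rewrite !big_nat_recr //= !INR_addn Rmult_plus_distr_l.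
apply: Rplus_le_compat; last by apply: fg; lia.
by apply: IH => t tb; apply: fg; lia.
Qed.

(** Eventual positivity, growth by a factor near [1] under a unit shift, and monotonicity. An
    arbitrary [eps] keeps the class stable when growth factors multiply. *)
Definition slow (F : R -> R) := forall eps, 0 < eps -> exists x0, forall x, x0 <= x ->
  [/\ 0 < F x, F (x + 1) <= (1 + eps) * F x & forall y, x <= y -> F x <= F y].

Lemma slow1 : slow (fun=> 1).
Proof. by move=> eps e0; exists 0 => x _; split=> [||y _]; lra. Qed.

Section Logarithm.
Variable k : nat.
Hypothesis k2 : (2 <= k)%N.

Lemma INR_k2 : 2 <= INR k.
Proof. exact: (INR_leq k2). Qed.

Lemma ln_k_gt0 : 0 < ln (INR k).
Proof. by rewrite -ln_1; apply: ln_increasing; have := INR_k2; lra. Qed.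

Lemma kpow_gt0 m : 0 < INR k ^ m.
Proof. by apply: pow_lt; have := INR_k2; lra. Qed.

Lemma logk_le x y : 0 < x -> x <= y -> logk k x <= logk k y.
Proof.
move=> x0 xy; apply: Rmult_le_compat_r; first by apply/Rlt_le/Rinv_0_lt_compat/ln_k_gt0.
by case: xy => [xy|->]; [apply/Rlt_le/ln_increasing|lra].
Qed.

Lemma logk_pow m : logk k (INR k ^ m) = INR m.
Proof.
rewrite /logk ln_pow; last by have := INR_k2; lra.
by field; have := ln_k_gt0; lra.
Qed.

Lemma logk_mul_pow x m : 0 < x -> logk k (x * INR k ^ m) = logk k x + INR m.
Proof.
move=> x0; rewrite -[in RHS](logk_pow m) /logk ln_mult //; last exact: kpow_gt0.
by field; have := ln_k_gt0; lra.
Qed.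

Lemma logk_unbounded y : exists x0, 0 < x0 /\ forall x, x0 <= x -> y <= logk k x.
Proof.
exists (exp (y * ln (INR k))); split=> [|x xy]; first exact: exp_pos.
have := logk_le (exp_pos _) xy; rewrite {1}/logk ln_exp.
have -> // : y * ln (INR k) / ln (INR k) = y by field; have := ln_k_gt0; lra.
Qed.

(** Since [x + 1 <= k x], a unit shift moves the logarithm by at most [1]: one factor [1 + e] comes
    from [x], another from [F]. *)
Lemma slow_mul_log F : slow F -> slow (fun x => x * F (logk k x)).
Proof.
(* For [e <= 1], [(1 + e)^2 <= 1 + 3 e <= 1 + eps]. *)
move=> sF eps e0; pose e := Rmin (eps / 3) 1.
have [e1 e2 e3] : [/\ 0 < e, e <= 1 & 3 * e <= eps].
  have := Rmin_l (eps / 3) 1; have := Rmin_r (eps / 3) 1.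
  by have : 0 < e by [apply: Rmin_pos; lra]; rewrite -/e; split; lra.
have [x0 Fx0] := sF e e1; have [x1 [x1p Hx1]] := logk_unbounded x0.
exists (Rmax x1 (/ e)) => x xmax.
have xx1 : x1 <= x by apply: Rle_trans (Rmax_l _ _) xmax.
have xe : / e <= x by apply: Rle_trans (Rmax_r _ _) xmax.
have ex : 1 <= e * x.
  by rewrite -(Rinv_r e); [apply: Rmult_le_compat_l; lra|lra].
have x1' : 1 <= x by nra.
have [Fp Fs Fm] := Fx0 _ (Hx1 x xx1); split.
- by apply: Rmult_lt_0_compat; lra.
- have l1 : logk k (x + 1) <= logk k x + 1.
    have -> : logk k x + 1 = logk k (x * INR k ^ 1) by rewrite logk_mul_pow //=; lra.
    by apply: logk_le; have := INR_k2; simpl; nra.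
  have l2 : logk k x <= logk k (x + 1) by apply: logk_le; lra.
  have x0l : x0 <= logk k (x + 1) by have := Hx1 x xx1; lra.
  have [_ _ /(_ _ l1) Fl] := Fx0 _ x0l.
  apply: (Rle_trans _ ((1 + e) * x * ((1 + e) * F (logk k x)))).
    apply: Rmult_le_compat; try lra.
    by have := Fm _ l2; lra.
  have : 0 < x * F (logk k x) by apply: Rmult_lt_0_compat; lra.
  have : (1 + e) * (1 + e) <= 1 + eps by nra.
  by nra.
- move=> y xy; apply: Rmult_le_compat; try lra.
  by apply: Fm; apply: logk_le; lra.
Qed.

Lemma nat_above x : exists m, x <= INR m.
Proof.
have [x0|x0] := Rle_lt_dec x 0; first by exists 0%N.
by have [m /Rlt_le] := INR_unbounded x; exists m.
Qed.

(** [k^L] at least doubles while [F] grows by at most [3/2], so the last term dominates the sum up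
    to a constant. *)
Lemma slow_partial_sum F (S : nat -> R) c N : slow F -> 0 < c ->
  (forall L, (N <= L)%N -> S L.+1 <= S L + c * INR k ^ L.+1 / F (INR L.+1)) ->
  exists M L0, 0 < M /\ forall L, (L0 <= L)%N -> S L <= M * INR k ^ L / F (INR L).
Proof.
move=> sF c0 HS; have [x0 Fx0] := sF (/ 2) ltac:(lra).
have [m xm] := nat_above x0; pose L0 := maxn N m.
have big L : (L0 <= L)%N -> x0 <= INR L.
  by move=> lL; apply: Rle_trans xm _; apply: INR_leq; lia.
(* [M >= 4 c] gives the induction step [3/2 M + c k <= M k]; the second argument settles the base
   case [L0]. *)
pose M := Rmax (4 * c) (S L0 * F (INR L0) / INR k ^ L0).
have M4 : 4 * c <= M by exact: Rmax_l.
exists M, L0; split=> [|L]; first lra.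
have base : S L0 <= M * INR k ^ L0 / F (INR L0).
  have [F0 _ _] := Fx0 _ (big L0 (leqnn _)); have K0 := kpow_gt0 L0.
  have -> : S L0 = S L0 * F (INR L0) / INR k ^ L0 * (INR k ^ L0 / F (INR L0)) by field; lra.
  rewrite /Rdiv (Rmult_assoc M); apply: Rmult_le_compat_r; last exact: Rmax_r.
  by apply/Rlt_le/Rdiv_lt_0_compat.
elim: L => [|L IH] lL; first by have -> : 0%N = L0 by lia.
have [lL'|Ll] := leqP L0 L; last by have -> : L.+1 = L0 by lia.
have [F0 + _] := Fx0 _ (big L lL'); rewrite -S_INR => F1.
have [F2 _ _] := Fx0 _ (big L.+1 lL).
have K0 := kpow_gt0 L; have k2' := INR_k2.
have i1 : / F (INR L) <= (3 / 2) * / F (INR L.+1).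
  have -> : 3 / 2 * / F (INR L.+1) = / (F (INR L.+1) / (3 / 2)) by field; lra.
  by apply: Rinv_le_contravar; lra.
apply: Rle_trans (HS _ _) _; first lia.
apply: Rle_trans (Rplus_le_compat_r _ _ _ (IH lL')) _.
have i2 : 0 < / F (INR L.+1) by exact: Rinv_0_lt_compat.
have M0 : 0 < M * INR k ^ L by apply: Rmult_lt_0_compat; lra.
apply: (Rle_trans _ (M * INR k ^ L * (3 / 2 * / F (INR L.+1)) + c * INR k ^ L.+1 / F (INR L.+1))).
  by apply/Rplus_le_compat_r/Rmult_le_compat_l; lra.
rewrite /Rdiv -Rmult_assoc -Rmult_plus_distr_r; apply: Rmult_le_compat_r; first lra.
have : 0 <= M * INR k ^ L * (INR k - 2) by apply: Rmult_le_pos; lra.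
have : 0 <= INR k * INR k ^ L * (M - 4 * c) by apply: Rmult_le_pos; [nra|lra].
by rewrite /=; lra.
Qed.


(** * Geometric sums and logarithmic scales *)

Lemma geometric_tail a n : (a <= n)%N ->
  (\sum_(a <= t < n) k ^ (n - t) <= 2 * k ^ (n - a))%N.
Proof.
(* The extra [2] absorbs the new term: [k S + k + 2 <= k (S + 2)]. *)
move=> an; have H : (\sum_(a <= t < n) k ^ (n - t) + 2 <= 2 * k ^ (n - a))%N.
  elim: n an => [|n IH] an; first by rewrite big_geq //= (_ : 0 - a = 0)%N //.
  have [an'|na] := leqP a n; last first.
    by rewrite big_geq // (_ : n.+1 - a = 0)%N ?expn0 //; lia.
  rewrite big_nat_recr //= subSnn expn1 subSn // expnS.
  have -> : (\sum_(a <= t < n) k ^ (n.+1 - t) = k * \sum_(a <= t < n) k ^ (n - t))%N.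
    rewrite big_distrr /= big_nat [RHS]big_nat; apply: eq_bigr => t tn.
    by rewrite subSn ?expnS //; lia.
  have := leq_mul (leqnn k) (IH an'); lia.
lia.
Qed.

Lemma eventually_trunc_log N : exists N', forall n, (N' <= n)%N ->
  [/\ (N <= trunc_log k n)%N, (4 * trunc_log k n <= n)%N & (1 < n)%N].
Proof.
exists (maxn 16 (k ^ N))%N => n; rewrite geq_max => /andP[n16 nN].
have lN : (N <= trunc_log k n)%N by apply: trunc_log_max.
have := trunc_logP k2 (leq_trans (isT : 0 < 16)%N n16); set L := trunc_log k n => kL.
have L4 : (4 * L <= n)%N.
  have [L5|L5] := leqP L 4; first lia.
  apply: leq_trans kL; have : (2 ^ L <= k ^ L)%N by rewrite leq_exp2r //; lia.
  apply: leq_trans; elim: (L) L5 => // m IH; rewrite ltnS leq_eqVlt => /orP[/eqP <- //|lm].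
  by rewrite expnS; have := IH lm; lia.
by split=> //; lia.
Qed.

(** The scale of the lower bound: [k^t] is large enough for [count_closed_lower], yet exceeds [n] by
    at most a constant factor. *)
Lemma eventually_up_log N : exists N', forall n, (N' <= n)%N ->
  [/\ (N < up_log k (4 * n))%N, (3 * up_log k (4 * n) < n)%N,
     (4 * n <= k ^ up_log k (4 * n))%N & (k ^ up_log k (4 * n) <= 4 * k * n)%N].
Proof.
exists (maxn 64 (k ^ N))%N => n; rewrite geq_max => /andP[n64 nN].
have := @up_log_bounds k (4 * n) k2 ltac:(lia); set t := up_log k (4 * n).
move=> /andP[tl tu].
have Nt : (N < t)%N by rewrite -(ltn_exp2l _ _ k2); apply: leq_ltn_trans nN _; lia.
have t0 : (0 < t)%N by lia.
split=> //; last by rewrite -(prednK t0) expnS; nia.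
(* [n <= 3 t] would give [k^(t-1) < 4 n <= 12 t], which fails from [t = 10] on. *)
rewrite ltnNge; apply/negP => nt.
have [t9|t9] := leqP t 9; first lia.
have : (2 ^ t.-1 <= k ^ t.-1)%N by rewrite leq_exp2r //; lia.
have : (12 * t <= 2 ^ t.-1)%N; last lia.
elim: {tl tu Nt nt} t t0 t9 => // -[//|t] IH _.
rewrite ltnS leq_eqVlt => /orP[/eqP [<-] //|lt].
by have := IH isT lt; rewrite /= expnS; lia.
Qed.

(** * Transfer of bounds from lengths near [log n] to length [n] *)

Local Notation T := 'I_k.

Definition upper_bounded (F : R -> R) := exists N c, 0 < c /\
  forall n, (N < n)%N -> INR (npriv T n) <= c * INR k ^ n / F (INR n).

(** Stated for privileged seeds because [nseed_recursion] has seeds on both sides. *)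
Definition lower_bounded (F : R -> R) := exists N c, 0 < c /\
  forall n, (N < n)%N -> c * INR k ^ n / F (INR n) <= INR (nseed T n).

(** Short and long borders together; the [1 +] absorbs the long ones. *)
Lemma npriv_sum_bound n L : (4 * L <= n)%N -> (2 * L < n)%N -> (n < k ^ L.+1)%N ->
  (n ^ 2 * (\sum_(1 <= t < L.+1) npriv_border T n t + \sum_((2 * L).+1 <= t < n) npriv_border T n t)
   <= (16 * k) * k ^ n * (1 + \sum_(1 <= t < L.+1) npriv T t))%N.
Proof.
move=> L4 L2 nk; rewrite mulnDr.
have S1 : (n ^ 2 * \sum_(1 <= t < L.+1) npriv_border T n t <=
    16 * k ^ n * \sum_(1 <= t < L.+1) npriv T t)%N.
  rewrite !big_distrr /= big_nat [X in (_ <= X)%N]big_nat; apply: leq_sum => t tL.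
  have := @npriv_border_small T n t ltac:(lia) ltac:(lia); rewrite card_ord.
  by rewrite mulnC [(16 * _ * _)%N]mulnC.
have S3 : (n ^ 2 * \sum_((2 * L).+1 <= t < n) npriv_border T n t <= 2 * k * k ^ n)%N.
  (* [n^2 <= k^(2L+2)] meets a geometric tail of at most [2 k^(n-2L-1)]. *)
  apply: (@leq_trans (k ^ L.+1 * k ^ L.+1 * (2 * k ^ (n - (2 * L).+1)))).
    rewrite -mulnn; apply: leq_mul; first by apply: leq_mul; exact: ltnW.
    apply: leq_trans (geometric_tail L2); rewrite big_nat [X in (_ <= X)%N]big_nat.
    apply: leq_sum => t tn; have := @npriv_border_large T n t ltac:(lia) ltac:(lia).
    by rewrite card_ord.
  rewrite mulnCA -!expnD -mulnA -expnS leq_mul2l /=.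
  by rewrite leq_exp2l //; lia.
move: S1 S3; set s := \sum_(1 <= t < L.+1) npriv T t; set K := (k ^ n)%N.
move: (n ^ 2 * _)%N (n ^ 2 * _)%N => a b; nia.
Qed.

Lemma upper_step F : slow F -> upper_bounded F ->
  upper_bounded (fun x => x * F (logk k x)).
Proof.
move=> sF [N [c [c0 HP]]]; have k2' := INR_k2.
have [M [L0 [M0 HM]]] : exists M L0, 0 < M /\ forall L, (L0 <= L)%N ->
    INR (1 + \sum_(1 <= t < L.+1) npriv T t)%N <= M * INR k ^ L / F (INR L).
  apply: (@slow_partial_sum _ _ c N) => // L NL.
  rewrite big_nat_recr // addnA INR_addn; apply: Rplus_le_compat_l; apply: HP; lia.
have [x0 Fx0] := sF 1 Rlt_0_1; have [m xm] := nat_above x0.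
have [N' HN'] := eventually_trunc_log (maxn N (maxn L0 m)).
(* [32 = 16 * 2], where [2] compares [F L] with [F (log n)]; [2 * c] comes from the geometric sum
   over [L < t <= 2L]. *)
exists N', (32 * INR k * M + 2 * c); split=> [|n /ltnW /HN'[]]; first nra.
set L := trunc_log k n => LN L4 n1.
have [n0 L2] : (0 < n)%N /\ (2 * L < n)%N by lia.
have /andP[kL kL1] := trunc_log_bounds k2 n0; rewrite -/L in kL kL1.
have nR : 0 < INR n by apply: lt_0_INR; apply/ltP.
have LR : x0 <= INR L by apply: Rle_trans xm _; apply: INR_leq; lia.
have lL : INR L <= logk k (INR n).
  by rewrite -logk_pow -INR_expn; apply: logk_le (INR_leq kL); rewrite INR_expn; exact: kpow_gt0.
have lL1 : logk k (INR n) <= INR L + 1.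
  by rewrite -S_INR -(logk_pow L.+1) -INR_expn; apply: logk_le nR (INR_leq (ltnW kL1)).
have [FL0 FL1 FL] := Fx0 _ LR.
have [Fn0 _ /(_ _ lL1) Fn] := Fx0 _ (Rle_trans _ _ _ LR lL).
have K0 := kpow_gt0 n.
set Fl := F (logk k (INR n)) in Fn0 Fn *; set E := INR k ^ n in K0 *.
have P3 := @npriv_le_sum T n ltac:(lia).
rewrite (@big_cat_nat _ _ _ L.+1) /= in P3; [|lia..].
rewrite (@big_cat_nat _ _ _ (2 * L).+1 L.+1) /= in P3; [|lia..].
have P2 := npriv_sum_bound L4 L2 kL1.
move: P2 P3; set s1 := \sum_(1 <= t < L.+1) npriv_border T n t.
set s2 := \sum_(L.+1 <= t < (2 * L).+1) _; set s3 := \sum_((2 * L).+1 <= t < n) _ => P2 P3.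
have B2 : INR s2 <= c / Fl * (2 * (E / INR n)).
  apply: (Rle_trans _ (c / Fl * INR (\sum_(L.+1 <= t < (2 * L).+1) k ^ (n - t)))).
    apply: INR_sum_le => t tL.
    have tn : (2 * t <= n)%N by lia.
    have t0 : (0 < t)%N by lia.
    apply: Rle_trans (INR_leq (npriv_border_medium 'I_k t0 tn)) _.
    rewrite card_ord INR_muln !INR_expn.
    have Kt : INR k ^ (n - t) = INR k ^ t * INR k ^ (n - 2 * t) by rewrite -pow_add; congr pow; lia.
    rewrite Kt -Rmult_assoc; apply: Rmult_le_compat_r; first exact/Rlt_le/kpow_gt0.
    apply: Rle_trans (HP t _) _; first lia.
    (* [log n <= L + 1 <= t], and [F] is monotone there. *)
    have FtL : Fl <= F (INR t).
      apply: Rle_trans Fn _; have [_ _] := Fx0 (INR L + 1) ltac:(lra); apply.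
      by rewrite -S_INR; apply: INR_leq; lia.
    have Kt0 := kpow_gt0 t.
    rewrite /Rdiv Rmult_assoc (Rmult_comm (INR k ^ t)) -Rmult_assoc.
    apply: Rmult_le_compat_r; first lra.
    by apply: Rmult_le_compat_l; [lra|apply: Rinv_le_contravar].
  apply: Rmult_le_compat_l; first by apply/Rlt_le/Rdiv_lt_0_compat.
  have tail : (\sum_(L.+1 <= t < (2 * L).+1) k ^ (n - t) <= 2 * k ^ (n - L.+1))%N.
    apply: leq_trans (@geometric_tail L.+1 n ltac:(lia)).
    by rewrite [X in (_ <= X)%N](@big_cat_nat _ _ _ (2 * L).+1) /= ?leq_addr //; lia.
  apply: Rle_trans (INR_leq tail) _; rewrite INR_muln INR_expn.
  apply: Rmult_le_compat_l; first exact: pos_INR.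
  have -> : E = INR k ^ L.+1 * INR k ^ (n - L.+1) by rewrite -pow_add; congr pow; lia.
  have Kl := kpow_gt0 (n - L.+1).
  have := INR_leq (ltnW kL1); rewrite INR_expn => nk.
  apply: (Rmult_le_reg_r _ _ _ nR); rewrite /Rdiv Rmult_assoc Rinv_l; last lra.
  by nra.
have B13 : INR (s1 + s3)%N <= 32 * INR k * M * E / (INR n * Fl) .
  have := INR_leq P2; rewrite !INR_muln !INR_expn -/E => P2R.
  have S0 := HM L (ltac:(lia)); have kLn := INR_leq kL; rewrite INR_expn in kLn.
  have iF : / F (INR L) <= 2 * / Fl.
    have -> : 2 * / Fl = / (Fl / 2) by field; lra.
    by apply: Rinv_le_contravar; lra.
  have iFl := Rinv_0_lt_compat _ Fn0; have iFL := Rinv_0_lt_compat _ FL0.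
  have S1 : INR (1 + \sum_(1 <= t < L.+1) npriv T t) <= M * INR n * (2 * / Fl).
    apply: Rle_trans S0 _; apply: Rmult_le_compat; try lra.
      by apply/Rlt_le/Rmult_lt_0_compat => //; exact: kpow_gt0.
    by apply: Rmult_le_compat_l; lra.
  apply: (Rmult_le_reg_l (INR n * INR n)); first exact: Rmult_lt_0_compat.
  apply: Rle_trans P2R _.
  have -> : INR n * INR n * (32 * INR k * M * E / (INR n * Fl)) =
      INR 16 * INR k * E * (M * INR n * (2 * / Fl)) by rewrite (_ : INR 16 = 16) /=; [field; lra|lra].
  apply: Rmult_le_compat_l S1; apply: Rmult_le_pos; last lra.
  by apply: Rmult_le_pos; exact: pos_INR.
apply: Rle_trans (INR_leq P3) _.
rewrite addnCA INR_addn.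
have -> : (32 * INR k * M + 2 * c) * E / (INR n * Fl) =
  c / Fl * (2 * (E / INR n)) + 32 * INR k * M * E / (INR n * Fl) by field; lra.
exact: Rplus_le_compat.
Qed.

Lemma upper_bounded1 : upper_bounded (fun=> 1).
Proof.
exists 0%N, 1; split=> [|n _]; first lra.
rewrite Rmult_1_l /Rdiv Rinv_1 Rmult_1_r -INR_expn -[k in (k ^ n)%N]card_ord -size_words.
exact/INR_leq/count_size.
Qed.

Lemma lower_step F : slow F -> lower_bounded F ->
  lower_bounded (fun x => x * F (logk k x)).
Proof.
move=> sF [N [c [c0 HQ]]]; have k2' := INR_k2.
have [x0 Fx0] := sF 1 Rlt_0_1; have [x1 [x1p Hx1]] := logk_unbounded x0.
have [m xm] := nat_above x1.
have [N' HN'] := eventually_up_log N.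
(* [128 k = 4 * 4k * 8]: the recursion, [k^t] against [n], and [F t] against [F (log n)]. *)
exists (maxn N' m), (c / (128 * INR k)); split=> [|n].
  by apply: Rdiv_lt_0_compat; lra.
rewrite gtn_max => /andP[/ltnW /HN'[]]; set t := up_log k (4 * n) => Nt tn nk kn mn.
have n0 : (0 < n)%N by lia.
have nR : 0 < INR n by apply: lt_0_INR; apply/ltP.
have lx0 : x0 <= logk k (INR n).
  by apply: Hx1; apply: Rle_trans xm _; apply: INR_leq; lia.
have knR : INR k ^ t <= 4 * INR k * INR n.
  have := INR_leq kn; rewrite INR_expn !INR_muln (_ : INR 4 = 4) //=; lra.
have ln_t : logk k (INR n) <= INR t.
  rewrite -(logk_pow t) -INR_expn; apply: logk_le nR (INR_leq _); lia.
(* [4 k n <= k^3 n], so [t] exceeds [log n] by at most three unit steps, each at most doubling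
   [F]. *)
have t_ln : INR t <= logk k (INR n) + 1 + 1 + 1.
  have -> : logk k (INR n) + 1 + 1 + 1 = logk k (INR n * INR k ^ 3).
    by rewrite logk_mul_pow //=; lra.
  rewrite -(logk_pow t); apply: logk_le; first exact: kpow_gt0.
  apply: Rle_trans knR _.
  have -> : INR n * INR k ^ 3 = INR k * INR k * (INR k * INR n) by rewrite /=; ring.
  rewrite Rmult_assoc; apply: Rmult_le_compat_r; nra.
have [F0 F1 Fm] := Fx0 _ lx0.
have [_ F2 _] := Fx0 (logk k (INR n) + 1) ltac:(lra).
have [_ F3 _] := Fx0 (logk k (INR n) + 1 + 1) ltac:(lra).
have [Ft0 _ /(_ _ t_ln) Ft] := Fx0 (INR t) ltac:(lra).
have := @nseed_recursion T n t; rewrite card_ord => /(_ k2 tn nk) /INR_leq.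
rewrite !INR_muln INR_expn (_ : INR 4 = 4); last by rewrite /=; lra.
move: F0 F1 F2 F3 Ft; set Fl := F (logk k (INR n)) => F0 F1 F2 F3 Ft R.
have Ft8 : F (INR t) <= 8 * Fl by lra.
have iF : / (8 * Fl) <= / F (INR t) by apply: Rinv_le_contravar.
have ik : / (4 * INR k * INR n) <= / INR k ^ t by apply: Rinv_le_contravar knR; exact: kpow_gt0.
have K0 := kpow_gt0 n; have Kt := kpow_gt0 t; have Km := kpow_gt0 (n - 2 * t).
have E : INR k ^ t * INR k ^ (n - 2 * t) = INR k ^ n * / INR k ^ t.
  have -> : INR k ^ n = INR k ^ t * INR k ^ t * INR k ^ (n - 2 * t).
    by rewrite -!pow_add; congr pow; lia.
  by field; lra.
have Q := Rmult_le_compat_r _ _ _ (Rlt_le _ _ Km) (HQ t Nt).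
have kn0 : 0 < 4 * INR k * INR n by nra.
have low : c * INR k ^ n * / (4 * INR k * INR n) * / (8 * Fl) <=
    c * INR k ^ t / F (INR t) * INR k ^ (n - 2 * t).
  have -> : c * INR k ^ t / F (INR t) * INR k ^ (n - 2 * t) =
      c * INR k ^ n * / INR k ^ t * / F (INR t).
    by rewrite /Rdiv Rmult_assoc (Rmult_comm (/ _)) -Rmult_assoc (Rmult_assoc c) E; ring.
  have i1 := Rinv_0_lt_compat _ kn0; have i2 : 0 < / (8 * Fl) by apply: Rinv_0_lt_compat; lra.
  have cK : 0 < c * INR k ^ n by exact: Rmult_lt_0_compat.
  apply: Rmult_le_compat => //; [nra|lra|].
  by apply: Rmult_le_compat_l; lra.
have -> : c / (128 * INR k) * INR k ^ n / (INR n * Fl) =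
  c * INR k ^ n * / (4 * INR k * INR n) * / (8 * Fl) / 4 by field; lra.
lra.
Qed.

(** A single seed of length [t] yields [k^(n-2t) / 4] words, and [k^t <= 4 k n] turns this into
    [k^n / (64 k^2 n^2)]. *)
Lemma lower_bounded_sqr : lower_bounded (fun x => x * x).
Proof.
have k2' := INR_k2; have [N HN] := eventually_up_log 3.
exists N, (/ (64 * INR k ^ 2)); split=> [|n /ltnW /HN[]].
  by apply: Rinv_0_lt_compat; have := kpow_gt0 2; lra.
set t := up_log k (4 * n) => t3 tn nk kn.
have n0 : (0 < n)%N by lia.
have nR : 0 < INR n by apply: lt_0_INR; apply/ltP.
have := @nseed_recursion T n t; rewrite card_ord => /(_ k2 tn nk).
have := @nseed_gt0 T t; rewrite card_ord => /(_ k2 t3) q0 R.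
have {q0} R : (k ^ (n - 2 * t) <= 4 * nseed T n)%N by apply: leq_trans R; rewrite leq_pmull.
have := INR_leq R; rewrite INR_muln INR_expn (_ : INR 4 = 4); last by rewrite /=; lra.
have knR : INR k ^ t <= 4 * INR k * INR n.
  have := INR_leq kn; rewrite INR_expn !INR_muln (_ : INR 4 = 4) //=; lra.
have Kt := kpow_gt0 t; have Km := kpow_gt0 (n - 2 * t).
have -> : INR k ^ n = INR k ^ t * INR k ^ t * INR k ^ (n - 2 * t).
  by rewrite -!pow_add; congr pow; lia.
have sq : INR k ^ t * INR k ^ t <= 16 * (INR k * INR k) * (INR n * INR n) by nra.
have kn0 : 0 < 64 * INR k ^ 2 * (INR n * INR n).
  by apply: Rmult_lt_0_compat; [have := kpow_gt0 2; lra|nra].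
move=> RR; apply: (Rle_trans _ (INR k ^ (n - 2 * t) / 4)); last lra.
apply: (Rmult_le_reg_r _ _ _ kn0).
have -> : / (64 * INR k ^ 2) * (INR k ^ t * INR k ^ t * INR k ^ (n - 2 * t)) / (INR n * INR n) *
  (64 * INR k ^ 2 * (INR n * INR n)) = INR k ^ t * INR k ^ t * INR k ^ (n - 2 * t).
  by field; split; lra.
by rewrite /=; nra.
Qed.

(** * Iterated logarithms and the induction on [j] *)

Lemma iterlogS j x : iterlog k j.+1 x = iterlog k j (logk k x).
Proof. by elim: j => [|j IH] //=; rewrite -IH. Qed.

(** Peels off the innermost logarithm, to match the substitution of [log x] in the transfer
    steps. *)
Lemma prodlogS j x : prodlog k j.+1 x = logk k x * prodlog k j (logk k x).
Proof.
elim: j => [|j IH]; first by rewrite /=; ring.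
by rewrite -[LHS]/(prodlog k j.+1 x * _) IH iterlogS Rmult_assoc.
Qed.

Lemma slow_sqr : slow (fun x => x * x).
Proof.
move=> eps e0; exists (Rmax 1 (3 / eps)) => x xm.
have x1 : 1 <= x by apply: Rle_trans (Rmax_l _ _) xm.
have xe : 3 / eps <= x by apply: Rle_trans (Rmax_r _ _) xm.
have ex : 3 <= eps * x.
  have -> : 3 = eps * (3 / eps) by field; lra.
  by apply: Rmult_le_compat_l; lra.
by split; [nra|nra|move=> y xy; nra].
Qed.

(** These functions satisfy [F_(j+1)(x) = x F_j(log x)], and [F_0] arises by one transfer from the
    trivial bound [k^n]. Slowness is carried along to feed the next transfer. *)
Lemma upper_bounded_prodlog j :
  let F x := x * prodlog k j x in slow F /\ upper_bounded F.
Proof.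
elim: j => [|j /= [sF uF]] /=.
  by split; [exact: (slow_mul_log slow1)|exact: (upper_step slow1 upper_bounded1)].
have -> : (fun x => x * (prodlog k j x * iterlog k j.+1 x)) =
    (fun x => x * (logk k x * prodlog k j (logk k x))).
  by apply: functional_extensionality => x; rewrite -prodlogS.
by split; [exact: (slow_mul_log sF)|exact: (upper_step sF uF)].
Qed.

(** The same functional equation holds here, started from [x * x]. *)
Lemma lower_bounded_prodlog j :
  let F x := x * iterlog k j x * prodlog k j x in slow F /\ lower_bounded F.
Proof.
elim: j => [|j [sF lF]].
  have -> : (fun x => x * iterlog k 0 x * prodlog k 0 x) = (fun x => x * x).
    by apply: functional_extensionality => x; rewrite Rmult_1_r.
  by split; [exact: slow_sqr|exact: lower_bounded_sqr].
have -> : (fun x => x * iterlog k j.+1 x * prodlog k j.+1 x) =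
    (fun x => x * (logk k x * iterlog k j (logk k x) * prodlog k j (logk k x))).
  by apply: functional_extensionality => x; rewrite prodlogS iterlogS; ring.
by split; [exact: (slow_mul_log sF)|exact: (lower_step sF lF)].
Qed.

End Logarithm.

Theorem theorem2 (k : nat) (hk : (2 <= k)%nat) :
  (forall j : nat, exists (N : nat) (c : R), (0 < N)%nat /\ (0 < c)%R /\
     forall n : nat, (N < n)%nat ->
       (c * (INR k ^ n) / (INR n * iterlog k j (INR n) * prodlog k j (INR n))
          <= INR (Pk k n))%R) /\
  (forall j : nat, exists (N : nat) (c : R), (0 < N)%nat /\ (0 < c)%R /\
     forall n : nat, (N < n)%nat ->
       (INR (Pk k n) <= c * (INR k ^ n) / (INR n * prodlog k j (INR n)))%R).
Proof.
have PkE n : Pk k n = npriv 'I_k n by exact: count_words.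
split=> j.
  have [_ [N [c [c0 H]]]] := lower_bounded_prodlog hk j.
  (* The successor makes the threshold positive. *)
  exists N.+1, c; split=> //; split=> // n Nn; rewrite PkE.
  by apply: Rle_trans (H n (ltnW Nn)) _; exact/INR_leq/nseed_le_npriv.
have [_ [N [c [c0 H]]]] := upper_bounded_prodlog hk j.
exists N.+1, c; split=> //; split=> // n Nn; rewrite PkE.
exact/H/ltnW.
Qed.
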